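(* Let $1<p<\infty$, $1/p+1/q=1$, and let $Z=\{z_k\}_{k\ge0}$ be a sequence of distinct nonzero points in $\mathbb{D}$. For $f_j$ to exist for all $j\ge0$ it is necessary and sufficient that $$\operatorname{dist}_{\ell^q_A}\big(\Lambda_{z_j},\operatorname{span}\{\Lambda_{z_k}\}_{k\ne j}\big)>0$$ for all $j$.
   Context: $\mathbb{D}$ is the open unit disk in $\mathbb{C}$. For $1<s<\infty$, $\ell^s_A$ is the space of analytic functions $f(z)=\sum_{n\ge 0}a_nz^n$ on $\mathbb{D}$ with $\|f\|_s:=(\sum_n|a_n|^s)^{1/s}<\infty$. For $w\in\mathbb{D}$, $\Lambda_w(z):=\sum_{k\ge0}w^kz^k\in\ell^q_A$. $f_j$ is the function in $\ell^p_A$ of minimum norm such that $(1-|z_j|^q)^{1/q}f_j(z_j)=1$ and $(1-|z_k|^q)^{1/q}f_j(z_k)=0$ for all $k\ne j$; it need not exist in general, and it exists (uniquely) exactly when some function in $\ell^p_A$ satisfies these conditions. *)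

(* Defs.v *)
From HB Require Import structures.
From mathcomp Require Import all_boot all_order all_algebra.
From mathcomp Require Import complex.
From mathcomp Require Import all_classical all_reals all_analysis.

Set Implicit Arguments.
Unset Strict Implicit.
Unset Printing Implicit Defensive.

Import Order.TTheory GRing.Theory Num.Theory.
Import numFieldNormedType.Exports.
Local Open Scope classical_set_scope.
Local Open Scope ring_scope.
Local Open Scope complex_scope.

Definition disk (R : realType) := {z : R[i] | `|z| < 1}.

(* The real-valued modulus; the library's [`|z|] is real but lives in [R[i]]. *)
Definition modulus (R : realType) (z : R[i]) : R := ComplexField.Normc.normc z.

(* Values are taken in [R[i]^o] (convertible to [R[i]]) because the library
   puts the topology of a numFieldType on its regular algebra. *)
Definition has_power_series (R : realType) (f : disk R -> R[i]^o)
    (a : nat -> R[i]) : Prop :=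
  forall z : disk R,
    series (fun n => a n * \val z ^+ n : R[i]^o) @ \oo --> f z.

(* Such a sequence is unique when it exists; the value is junk otherwise. *)
Definition taylor_coef (R : realType) (f : disk R -> R[i]^o) : nat -> R[i] :=
  xget (fun=> 0) [set a | has_power_series f a].

Definition analytic (R : realType) (f : disk R -> R[i]^o) : Prop :=
  exists a, has_power_series f a.

Definition ellA_norm (R : realType) (s : R) (f : disk R -> R[i]^o) : \bar R :=
  ((\sum_(0 <= n <oo) ((modulus (taylor_coef f n)) `^ s)%:E) `^ s^-1)%E.

Definition ellA (R : realType) (s : R) : set (disk R -> R[i]^o) :=
  [set f | analytic f /\ (ellA_norm s f < +oo)%E].

Definition Lambda (R : realType) (w z : disk R) : R[i]^o :=
  limn (series (fun k => \val w ^+ k * \val z ^+ k : R[i]^o)).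

Definition lspan (K : nzRingType) (V : lmodType K) (A : set V) : set V :=
  [set v | exists (n : nat) (c : 'I_n -> K) (u : 'I_n -> V),
     (forall i, A (u i)) /\ v = \sum_(i < n) c i *: u i].

Definition ellA_dist (R : realType) (s : R) (f : disk R -> R[i]^o)
    (A : set (disk R -> R[i]^o)) : \bar R :=
  ereal_inf [set ellA_norm s (f - g) | g in A].

Definition weight (R : realType) (q : R) (z : disk R) : R :=
  (1 - modulus (\val z) `^ q) `^ q^-1.

Definition interpolants (R : realType) (p q : R) (Z : nat -> disk R) (j : nat) :
    set (disk R -> R[i]^o) :=
  [set f | [/\ ellA p f,
               (weight q (Z j))%:C * f (Z j) = 1
             & forall k, k != j -> (weight q (Z k))%:C * f (Z k) = 0]].

Definition is_min_interpolant (R : realType) (p q : R) (Z : nat -> disk R)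
    (j : nat) (f : disk R -> R[i]^o) : Prop :=
  interpolants p q Z j f /\
  forall g, interpolants p q Z j g -> (ellA_norm p f <= ellA_norm p g)%E.

(* Main.v *)
Require Import Defs.
From HB Require Import structures.
From mathcomp Require Import all_boot all_order all_algebra.
From mathcomp Require Import complex.
From mathcomp Require Import ring lra.
From mathcomp Require Import all_classical all_reals all_analysis.

(** Write [a] for the coefficient sequence of a function.  Evaluation at [z_k] is
    the bilinear pairing of [a] with the coefficients of [Lambda_(z_k)], so the
    question is whether some [a] in l^p annihilates every [Lambda_(z_k)] with
    [k != j] without annihilating [Lambda_(z_j)].

    If it does, Hoelder's inequality for [a] and [Lambda_(z_j) - g], with [g] in
    the span of the other kernels, bounds the norm of [Lambda_(z_j) - g] below by
    a positive constant ([interpolant_dist_gt0]).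

    Conversely, let [m > 0] be the [q]-th power of the distance.  The annihilator
    comes from the extremal problem.  Take [y_n] in [Lambda_(z_j) - span] with
    [sum |y_n|^q <= m + t_n^2] and [t_n -> 0], let [G] be their coordinatewise
    limit along an ultrafilter, and put [a = |G|^(q-2) conj G].  By Fatou's lemma
    [sum |a|^p = sum |G|^q <= m].  Moving [y_n] by [t_n c Lambda_w], where [w] is
    one of the nodes, gives another competitor (up to a scalar when [w = z_j]),
    whose power sum is therefore bounded below.  The gradient inequality at the
    moved point turns this into a lower bound for [Re (c a(w))], because the
    excess [t_n^2] is negligible before the step [t_n]
    ([limit_first_variation]).  For [w = z_k] and [c = 1, -1, i, -i] this forces
    [a(z_k) = 0]; for [w = z_j] and [c = 1] it gives [m <= Re a(z_j)]
    ([extremal_functional]).  Coordinatewise limits suffice because the kernels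
    decay geometrically: pairings of bounded sequences with them are continuous
    for coordinatewise convergence.

    Let [W] be the weight at [z_j].  The same [a], rescaled to take the value
    [1 / W] at [z_j], has norm at most [1 / (W m^(1/q))], and by Hoelder's
    inequality no interpolant has a smaller norm, so it is a minimizer
    ([min_interpolant_exists]).  Uniqueness is the strict convexity of [|.|^p],
    applied coefficient by coefficient ([min_interpolant_unique]).  Norms are
    computed from Taylor coefficients, which are well defined by the identity
    theorem [has_power_series0_eq0]. *)

Set Implicit Arguments.
Unset Strict Implicit.
Unset Printing Implicit Defensive.

Import Order.TTheory GRing.Theory Num.Theory.
Import numFieldNormedType.Exports.
Local Open Scope classical_set_scope.
Local Open Scope ring_scope.
Local Open Scope complex_scope.

(** * The modulus and limits of complex sequences *)

Section ComplexLimits.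
Context {R : realType}.
Implicit Types (z w : R[i]) (x r M : R).

Lemma modulusE z : `|z| = (modulus z)%:C.
Proof. by case: z => a b; rewrite normc_def. Qed.

Lemma modulus_ge0 z : 0 <= modulus z.
Proof. by case: z => a b; exact: sqrtr_ge0. Qed.

Lemma modulus0 : modulus (0 : R[i]) = 0.
Proof. exact: Normc.normc0. Qed.

Lemma modulus1 : modulus (1 : R[i]) = 1.
Proof. exact: Normc.normc1. Qed.

Lemma modulus_eq0 z : (modulus z == 0) = (z == 0).
Proof.
by apply/eqP/eqP => [/Normc.eq0_normc //|->]; exact: modulus0.
Qed.

Lemma modulusM z w : modulus (z * w) = modulus z * modulus w.
Proof. exact: Normc.normcM. Qed.

Lemma modulusV z : modulus z^-1 = (modulus z)^-1.
Proof. exact: Normc.normcV. Qed.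

Lemma modulusX z n : modulus (z ^+ n) = modulus z ^+ n.
Proof.
elim: n => [|n ih]; first by rewrite !expr0 modulus1.
by rewrite !exprS modulusM ih.
Qed.

Lemma modulusD z w : modulus (z + w) <= modulus z + modulus w.
Proof. exact: le_normcD. Qed.

Lemma modulusN z : modulus (- z) = modulus z.
Proof. exact: normcN. Qed.

Lemma modulusB z w : modulus (z - w) = modulus (w - z).
Proof. by rewrite -modulusN opprB. Qed.

Lemma modulus_conj z : modulus z^*%C = modulus z.
Proof. by case: z => a b; rewrite /modulus /= sqrrN. Qed.

Lemma modulus_real x : modulus x%:C = `|x|.
Proof. by rewrite /modulus /= expr0n addr0 sqrtr_sqr. Qed.

Lemma Re_le_modulus z : `|complex.Re z| <= modulus z.
Proof. by rewrite -lecR -modulusE; exact: normc_ge_Re. Qed.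

Lemma Im_le_modulus z : `|complex.Im z| <= modulus z.
Proof.
case: z => a b; rewrite /modulus /= -sqrtr_sqr.
by rewrite ler_wsqrtr // lerDr sqr_ge0.
Qed.

Lemma modulus_le_ReIm z : modulus z <= `|complex.Re z| + `|complex.Im z|.
Proof.
rewrite [z in modulus z]complexE (le_trans (modulusD _ _)) //.
rewrite modulusM !modulus_real lerD2l.
by rewrite /modulus /= expr0n expr1n add0r sqrtr1 mul1r.
Qed.

Lemma modulus_sum (I : Type) (s : seq I) (P : pred I) (F : I -> R[i]) :
  modulus (\sum_(i <- s | P i) F i) <= \sum_(i <- s | P i) modulus (F i).
Proof.
elim/big_ind2: _ => [|z x w y zx wy|//]; first by rewrite modulus0.
by rewrite (le_trans (modulusD _ _)) // lerD.
Qed.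

Lemma modulus_distr z w : `|modulus z - modulus w| <= modulus (z - w).
Proof.
rewrite ler_norml; apply/andP; split.
  rewrite lerNl opprB lerBlDr modulusB (le_trans _ (modulusD _ _)) //.
  by rewrite subrK.
by rewrite lerBlDr (le_trans _ (modulusD _ _)) // subrK.
Qed.

(** A positive element of [R[i]] is real, so the balls of the complex topology
    are the balls of positive real radius. *)
Lemma cvg_modulusP (T : Type) (F : set_system T) {FF : Filter F}
    (u : T -> R[i]^o) (l : R[i]^o) :
  u @ F --> l <-> (fun t => modulus (u t - l)) @ F --> (0 : R).
Proof.
split=> [/cvgrPdist_lt ul|/cvgrPdist_lt ul]; apply/cvgrPdist_lt => e e0.
- have := ul e%:C; rewrite ltcR => /(_ e0); apply: filterS => t.
  rewrite modulusE ltcR sub0r normrN modulusB.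
  by rewrite ger0_norm ?modulus_ge0.
- have eE : (complex.Re e)%:C = e by rewrite RRe_real // gtr0_real.
  have := ul (complex.Re e); rewrite -ltcR eE => /(_ e0).
  apply: filterS => t.
  rewrite sub0r normrN ger0_norm ?modulus_ge0 // modulusB.
  by rewrite -ltcR eE -modulusE.
Qed.

Lemma cvg_modulus (T : Type) (F : set_system T) {FF : Filter F}
    (u : T -> R[i]^o) (l : R[i]^o) :
  u @ F --> l -> (fun t => modulus (u t)) @ F --> (modulus l : R).
Proof.
move=> /cvg_modulusP /cvgrPdist_lt ul; apply/cvgrPdist_lt => e /ul.
apply: filterS => t; apply: le_lt_trans.
rewrite sub0r normrN [leRHS]ger0_norm ?modulus_ge0 // modulusB.
exact: modulus_distr.
Qed.

Lemma cvg_Re (T : Type) (F : set_system T) {FF : Filter F}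
    (u : T -> R[i]^o) (l : R[i]^o) :
  u @ F --> l -> (fun t => complex.Re (u t)) @ F --> (complex.Re l : R).
Proof.
move=> /cvg_modulusP /cvgrPdist_lt ul; apply/cvgrPdist_lt => e /ul.
apply: filterS => t; apply: le_lt_trans.
rewrite sub0r normrN [leRHS]ger0_norm ?modulus_ge0 // modulusB.
by apply: le_trans (Re_le_modulus _); rewrite raddfB.
Qed.

Lemma cvg_Im (T : Type) (F : set_system T) {FF : Filter F}
    (u : T -> R[i]^o) (l : R[i]^o) :
  u @ F --> l -> (fun t => complex.Im (u t)) @ F --> (complex.Im l : R).
Proof.
move=> /cvg_modulusP /cvgrPdist_lt ul; apply/cvgrPdist_lt => e /ul.
apply: filterS => t; apply: le_lt_trans.
rewrite sub0r normrN [leRHS]ger0_norm ?modulus_ge0 // modulusB.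
by apply: le_trans (Im_le_modulus _); rewrite raddfB.
Qed.

Lemma cvg_complex (T : Type) (F : set_system T) {FF : Filter F}
    (a b : T -> R) (x y : R) :
  a @ F --> x -> b @ F --> y ->
  (fun t => (a t +i* b t : R[i]^o)) @ F --> (x +i* y : R[i]^o).
Proof.
move=> ax bY; apply/cvg_modulusP; apply/cvgrPdist_lt => e e0.
have e20 : 0 < e / 2 by rewrite divr_gt0.
move/cvgrPdist_lt : ax => /(_ _ e20) ax.
move/cvgrPdist_lt : bY => /(_ _ e20) bY.
near=> t; rewrite sub0r normrN ger0_norm ?modulus_ge0 //.
rewrite (le_lt_trans (modulus_le_ReIm _)) //= (splitr e) ltrD //.
- by rewrite distrC; near: t.
- by rewrite distrC; near: t.
Unshelve. all: by end_near. Qed.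

(** Nonnegativity of [u] matters when [l = 0], since [powR] is constantly [1] on
    the negative half-line. *)
Lemma powR_cvg_nneg (T : Type) (F : set_system T) {FF : Filter F}
    (u : T -> R) (l s : R) :
  0 < s -> (forall t, 0 <= u t) -> 0 <= l -> u @ F --> l ->
  (fun t => u t `^ s) @ F --> l `^ s.
Proof.
move=> s0 u0; rewrite le_eqVlt => /predU1P[<-|l0] ul; last first.
  have /differentiable_continuous lc : differentiable (fun x : R => x `^ s) l.
    apply/derivable1_diffP; apply: derivable_powR.
    by rewrite in_itv /= andbT.
  exact: cvg_comp ul lc.
rewrite powR0 ?gt_eqF //; apply/cvgrPdist_lt => e e0.
have : 0 < e `^ s^-1 by rewrite powR_gt0.
move/cvgrPdist_lt : ul => /[apply]; apply: filterS => t.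
rewrite !sub0r !normrN ger0_norm // ger0_norm ?powR_ge0 // => ute.
rewrite -[ltRHS](_ : (e `^ s^-1) `^ s = e).
  by rewrite gt0_ltr_powR // nnegrE // powR_ge0.
by rewrite -powRrM mulVf ?gt_eqF // powRr1 // ltW.
Qed.

End ComplexLimits.

(** * Geometrically bounded series *)

Section GeometricSeries.
Context {R : realType}.
Implicit Types (M r : R).

Lemma geometric_sum_le r (N n : nat) :
  0 <= r -> r < 1 -> \sum_(N <= k < n) r ^+ k <= r ^+ N / (1 - r).
Proof.
move=> r0 r1; have r10 : 0 < 1 - r by rewrite subr_gt0.
rewrite ler_pdivlMr //.
have [Nn|nN] := leqP N n; last first.
  by rewrite big_geq ?mul0r ?exprn_ge0 // ltnW.
rewrite -(subnKC Nn); set m := (n - N)%N.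
suff -> : (\sum_(N <= k < N + m) r ^+ k) * (1 - r) = r ^+ N - r ^+ (N + m).
  by rewrite lerBlDr lerDl exprn_ge0.
elim: m => [|k ih]; first by rewrite addn0 big_geq // mul0r subrr.
by rewrite addnS big_nat_recr /= ?leq_addr // mulrDl ih exprS; ring.
Qed.

Lemma modulus_series_tail (c : nat -> R[i]) M r (N n : nat) :
  0 <= r -> r < 1 -> (forall k, modulus (c k) <= M * r ^+ k) ->
  modulus (\sum_(N <= k < n) c k) <= M * (r ^+ N / (1 - r)).
Proof.
move=> r0 r1 cM; have M0 : 0 <= M.
  by have := le_trans (modulus_ge0 _) (cM 0%N); rewrite expr0 mulr1.
rewrite (le_trans (modulus_sum _ _ _)) //.
apply: (@le_trans _ _ (\sum_(N <= k < n) M * r ^+ k)).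
  by apply: ler_sum => k _.
by rewrite -mulr_sumr ler_wpM2l // geometric_sum_le.
Qed.

Lemma geometric_series_cvg (c : nat -> R[i]) M r :
  0 <= r -> r < 1 -> (forall k, modulus (c k) <= M * r ^+ k) ->
  cvgn (series (c : nat -> R[i]^o)).
Proof.
move=> r0 r1 cM.
have geoM : cvgn (series (fun k => M * r ^+ k)).
  by apply: (@is_cvg_geometric_series _ M r); rewrite ger0_norm.
have cvgp (v : nat -> R) : (forall k, `|v k| <= modulus (c k)) ->
    cvgn (series v).
  move=> vc; apply: normed_cvg; apply: series_le_cvg geoM => k.
  - exact: normr_ge0.
  - exact: le_trans (modulus_ge0 _) (cM k).
  - exact: le_trans (vc k) (cM k).
have cre := cvgp _ (fun k => Re_le_modulus (c k)).
have cim := cvgp _ (fun k => Im_le_modulus (c k)).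
apply/cvg_ex; exists (limn (series (fun k => complex.Re (c k)))
  +i* limn (series (fun k => complex.Im (c k)))).
apply: cvg_trans (cvg_complex cre cim); apply: near_eq_cvg.
near=> n; rewrite /series /=.
by elim/big_rec3: _ => [//|i x y z _ <-]; case: (c i).
Unshelve. all: by end_near. Qed.

(** Explicit control of the tails, uniform in the coefficients: it lets
    coordinatewise limits pass through evaluation at a point of the disk. *)
Lemma geometric_series_tail (c : nat -> R[i]) M r (s : R[i]^o) (N : nat) :
  0 <= r -> r < 1 -> (forall k, modulus (c k) <= M * r ^+ k) ->
  series (c : nat -> R[i]^o) @ \oo --> s ->
  modulus (s - \sum_(0 <= k < N) c k) <= M * (r ^+ N / (1 - r)).
Proof.
move=> r0 r1 cM cs.
have cst : (fun=> \sum_(0 <= k < N) c k : R[i]^o) @ \oo -->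
  (\sum_(0 <= k < N) c k : R[i]^o) by exact: cvg_cst.
apply: (cvgr_to_le (cvg_modulus (cvgB cs cst))).
exists N => // n /= Nn.
rewrite !fctE /series /= (big_cat_nat _ (n := N)) //= addrAC subrr add0r.
exact: modulus_series_tail.
Qed.

End GeometricSeries.

(** * Power series on the disk *)

Section PowerSeries.
Context {R : realType}.
Implicit Types (a b : nat -> R[i]) (z : R[i]) (M : R) (f : disk R -> R[i]^o).

(** For fixed [z] this is the pairing of [a] with the kernel at [z]; by symmetry
    [Lambda w] is [evalps] of the powers of [w]. *)
Definition evalps a z : R[i]^o := limn (series (fun k => a k * z ^+ k : R[i]^o)).

Lemma modulus_disk (z : disk R) : modulus (\val z) < 1.
Proof. by case: z => z /= z1; rewrite -ltcR -modulusE. Qed.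

Section BoundedCoefficients.
Variables (a : nat -> R[i]) (M : R) (z : R[i]).
Hypothesis aM : forall k, modulus (a k) <= M.
Hypothesis z1 : modulus z < 1.

Let term_le k : modulus (a k * z ^+ k) <= M * modulus z ^+ k.
Proof. by rewrite modulusM modulusX ler_wpM2r // exprn_ge0 // modulus_ge0. Qed.

Lemma evalps_cvg : series (fun k => a k * z ^+ k : R[i]^o) @ \oo --> evalps a z.
Proof. exact: geometric_series_cvg (modulus_ge0 z) z1 term_le. Qed.

Lemma evalps_modulus_cvg :
  (fun N => modulus (\sum_(0 <= k < N) a k * z ^+ k)) @ \oo -->
  modulus (evalps a z).
Proof. exact: cvg_modulus evalps_cvg. Qed.

Lemma evalps_tail (N : nat) :
  modulus (evalps a z - \sum_(0 <= k < N) a k * z ^+ k) <=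
  M * (modulus z ^+ N / (1 - modulus z)).
Proof.
exact: geometric_series_tail (modulus_ge0 z) z1 term_le evalps_cvg.
Qed.

End BoundedCoefficients.

Lemma has_power_series_evalps a M :
  (forall k, modulus (a k) <= M) ->
  has_power_series (fun z : disk R => evalps a (\val z)) a.
Proof. by move=> aM z; apply: (evalps_cvg aM); exact: modulus_disk. Qed.

Lemma Lambda_power_series (w : disk R) :
  has_power_series (Lambda w) (fun k => \val w ^+ k).
Proof.
apply: (@has_power_series_evalps _ 1) => k.
by rewrite modulusX exprn_ile1 ?modulus_ge0 // ltW // modulus_disk.
Qed.

Lemma has_power_seriesD f g a b : has_power_series f a ->
  has_power_series g b -> has_power_series (f + g) (fun k => a k + b k).
Proof.
move=> fa gb z.
rewrite [X in X @ _ --> _](_ : _ = series (fun k => a k * \val z ^+ k : R[i]^o)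
  \+ series (fun k => b k * \val z ^+ k : R[i]^o)); first exact: cvgD.
apply/funext => n; rewrite /series /= -big_split /=.
by apply: eq_bigr => k _; rewrite mulrDl.
Qed.

Lemma has_power_seriesZ f a (c : R[i]) : has_power_series f a ->
  has_power_series (c *: f) (fun k => c * a k).
Proof.
move=> fa z.
rewrite [X in X @ _ --> _](_ : _ =
  c \*: series (fun k => a k * \val z ^+ k : R[i]^o)).
  exact: (@cvgZl_tmp R[i] R[i]^o _ \oo _ c _ _ (fa z)).
apply/funext => n; rewrite /series /= scaler_sumr.
by apply: eq_bigr => k _; rewrite -mulrA.
Qed.

Lemma has_power_series0 : has_power_series (0 : disk R -> R[i]^o) (fun=> 0).
Proof.
move=> z; rewrite [X in X @ _ --> _](_ : _ = fun=> 0 : R[i]^o).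
  exact: cvg_cst.
by apply/funext => n; rewrite /series /= big1 // => k _; rewrite mul0r.
Qed.

(** Identity theorem at the origin: a convergent series has geometrically
    bounded terms, so the [m]-th term is the leading one as [r -> 0]. *)
Lemma has_power_series0_eq0 c :
  has_power_series (0 : disk R -> R[i]^o) c -> forall m, c m = 0.
Proof.
move=> c0.
have {}c0 (x : R) : 0 <= x -> x < 1 ->
    series (fun k => c k * x%:C ^+ k : R[i]^o) @ \oo --> (0 : R[i]^o).
  move=> x0 x1; have xd : `|x%:C : R[i]| < 1.
    by rewrite modulusE modulus_real ltcR ger0_norm.
  exact: (c0 (exist (fun z : R[i] => `|z| < 1) x%:C xd)).
have [M cM] : exists M : R, forall k, modulus (c k) * 2^-1 ^+ k <= M.
  have cv : cvgn (series (fun k => c k * (2^-1)%:C ^+ k : R[i]^o)).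
    by apply/cvg_ex; exists (0 : R[i]^o); apply: c0; lra.
  have [M [_ MP]] :=
    cvg_seq_bounded (cvgP _ (cvg_modulus (cvg_series_cvg_0 cv))).
  exists (M + 1) => k.
  have := MP (M + 1); rewrite ltrDl ltr01 => /(_ isT k I) /=.
  apply: le_trans; rewrite ger0_norm ?modulus_ge0 //.
  by rewrite modulusM modulusX modulus_real [in leRHS]ger0_norm.
have cM2 k : modulus (c k) <= M * 2 ^+ k.
  by rewrite -ler_pdivrMr ?exprn_gt0 // -exprVn cM.
have M0 : 0 <= M by rewrite (le_trans _ (cM 0%N)) // mulr_ge0 ?modulus_ge0.
move=> m; elim/ltn_ind: m => m ih.
apply/eqP; rewrite -modulus_eq0 eq_le modulus_ge0 andbT.
apply/ler_addgt0Pl => e e0; rewrite addr0.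
pose r : R := Num.min 4^-1 (e / (M * 2 ^+ m.+2 + 1)).
have D0 : 0 < M * 2 ^+ m.+2 + 1.
  by rewrite ltr_wpDl // mulr_ge0 // exprn_ge0.
have r0 : 0 < r by rewrite lt_min invr_gt0 ltr0n divr_gt0.
have r4 : r <= 4^-1 by rewrite ge_min lexx.
have rD : r * (M * 2 ^+ m.+2) <= e.
  have : r <= e / (M * 2 ^+ m.+2 + 1) by rewrite ge_min lexx orbT.
  rewrite ler_pdivlMr // => /(le_trans _); apply.
  by rewrite ler_pM2l // lerDl.
have tl : modulus (0 - \sum_(0 <= k < m.+1) c k * r%:C ^+ k) <=
    M * ((2 * r) ^+ m.+1 / (1 - 2 * r)).
  apply: (@geometric_series_tail _ (fun k => c k * r%:C ^+ k)).
  - by rewrite mulr_ge0 // ltW.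
  - lra.
  - move=> k; rewrite modulusM modulusX modulus_real ger0_norm ?(ltW r0) //.
    by rewrite exprMn mulrA ler_wpM2r ?exprn_ge0 ?(ltW r0).
  - by apply: c0; lra.
move: tl; rewrite sub0r modulusN big_nat_recr //= big_nat big1 ?add0r; last first.
  by move=> k /andP[_ km]; rewrite ih // mul0r.
rewrite modulusM modulusX modulus_real ger0_norm ?(ltW r0) //.
have -> : M * ((2 * r) ^+ m.+1 / (1 - 2 * r)) =
    r * (M * 2 ^+ m.+1 / (1 - 2 * r)) * r ^+ m.
  by rewrite exprMn (exprS r); ring.
rewrite ler_pM2r ?exprn_gt0 // => /le_trans; apply.
apply: le_trans rD; rewrite ler_pM2l //.
rewrite ler_pdivrMr; last by lra.
rewrite (exprS 2 m.+1).
have : 0 <= M * 2 ^+ m.+1 by rewrite mulr_ge0 // exprn_ge0.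
set X := M * 2 ^+ m.+1 => X0; rewrite mulrCA -/X; nra.
Qed.

Lemma taylor_coefE f a : has_power_series f a -> taylor_coef f = a.
Proof.
move=> fa; rewrite /taylor_coef.
case: xgetP => [b _ fb|/(_ a) //]; apply/funext => m.
have := has_power_seriesD fb (has_power_seriesZ (c := -1) fa).
rewrite scaleN1r subrr => /has_power_series0_eq0 /(_ m).
by rewrite mulN1r => /eqP; rewrite subr_eq0 => /eqP.
Qed.

Lemma has_power_series_fun f g a :
  has_power_series f a -> has_power_series g a -> f = g.
Proof. by move=> fa ga; apply/funext => z; exact: cvg_unique (fa z) (ga z). Qed.

End PowerSeries.

(** * Power sums of coefficients *)

Section CoefficientNorms.
Context {R : realType}.
Implicit Types (a b : nat -> R[i]) (s B : R) (f : disk R -> R[i]^o).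

(** [sum |a_k|^s <= B], stated through partial sums so that the estimates take
    place among finite sums of reals. *)
Definition lp_sum_le s a B :=
  forall N, \sum_(0 <= k < N) modulus (a k) `^ s <= B.

Lemma lp_sum_le_ge0 s a B : lp_sum_le s a B -> 0 <= B.
Proof. by move=> /(_ 0%N); rewrite big_geq. Qed.

Lemma lp_sum_le_term s a B k : lp_sum_le s a B -> modulus (a k) `^ s <= B.
Proof.
move=> /(_ k.+1); rewrite big_nat_recr //=; apply: le_trans.
by rewrite lerDr sumr_ge0 // => i _; exact: powR_ge0.
Qed.

Lemma powRVK s x : 0 < s -> 0 <= x -> (x `^ s^-1) `^ s = x :> R.
Proof. by move=> s0 x0; rewrite -powRrM mulVf ?gt_eqF // powRr1. Qed.

Lemma powRKV s x : 0 < s -> 0 <= x -> (x `^ s) `^ s^-1 = x :> R.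
Proof. by move=> s0 x0; rewrite -powRrM mulfV ?gt_eqF // powRr1. Qed.

Lemma powR_div_root s t x : 0 < s -> 0 <= t -> 0 <= x ->
  (t / x `^ s^-1) `^ s = t `^ s / x :> R.
Proof.
move=> s0 t0 x0; rewrite powRM ?invr_ge0 ?powR_ge0 //; congr (_ * _).
by rewrite -powRN -powRrM mulNr mulVf ?gt_eqF // powR_inv1.
Qed.

Lemma lp_sum_le_bounded s a B : 0 < s -> lp_sum_le s a B ->
  forall k, modulus (a k) <= B `^ s^-1.
Proof.
move=> s0 aB k; rewrite -[leLHS](powRKV s0) ?modulus_ge0 //.
rewrite ge0_ler_powR ?invr_ge0 ?nnegrE ?powR_ge0 ?(ltW s0) //.
- exact: lp_sum_le_ge0 aB.
- exact: lp_sum_le_term aB.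
Qed.

Lemma lp_sum_leZ s a B c : lp_sum_le s a B ->
  lp_sum_le s (fun k => c * a k) (modulus c `^ s * B).
Proof.
move=> aB N; under eq_bigr do rewrite modulusM powRM ?modulus_ge0 //.
by rewrite -mulr_sumr ler_wpM2l ?powR_ge0.
Qed.

Lemma geometric_lp_sum_le s a M r : 0 < s -> 0 <= r -> r < 1 ->
  (forall k, modulus (a k) <= M * r ^+ k) -> exists B, lp_sum_le s a B.
Proof.
move=> s0 r0 r1 aM.
have M0 : 0 <= M.
  by have := le_trans (modulus_ge0 _) (aM 0%N); rewrite expr0 mulr1.
have rs0 : 0 <= r `^ s by exact: powR_ge0.
have rs1 : r `^ s < 1.
  have <- : 1 `^ s = 1 :> R by rewrite powR1.
  by rewrite gt0_ltr_powR // nnegrE.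
exists (M `^ s * ((r `^ s) ^+ 0 / (1 - r `^ s))) => N.
apply: (@le_trans _ _ (\sum_(0 <= k < N) M `^ s * (r `^ s) ^+ k)).
  apply: ler_sum => k _.
  rewrite -powR_mulrn // powRAC powR_mulrn // -powRM ?exprn_ge0 //.
  by rewrite ge0_ler_powR ?nnegrE ?(ltW s0) ?modulus_ge0 ?mulr_ge0 ?exprn_ge0.
by rewrite -mulr_sumr ler_wpM2l ?powR_ge0 // geometric_sum_le.
Qed.

Lemma lp_seriesP s a B :
  (\sum_(0 <= n <oo) (modulus (a n) `^ s)%:E <= B%:E)%E <-> lp_sum_le s a B.
Proof.
split=> [aB N|aB].
  rewrite -lee_fin -sumEFin; apply: le_trans aB.
  by apply: nneseries_lim_ge => k _ _; rewrite lee_fin powR_ge0.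
apply: lime_le.
  by apply: is_cvg_nneseries => k _ _; rewrite lee_fin powR_ge0.
by apply: nearW => N; rewrite sumEFin lee_fin.
Qed.

(** The passage between the extended norm of a function and real bounds on the
    coefficients. *)
Lemma ellA_norm_leP s f a B : 0 < s -> 0 <= B -> has_power_series f a ->
  (ellA_norm s f <= (B `^ s^-1)%:E)%E <-> lp_sum_le s a B.
Proof.
move=> s0 B0 fa; rewrite /ellA_norm (taylor_coefE fa) -lp_seriesP.
set S := (\sum_(_ <= _ <oo) _)%E.
have S0 : (0 <= S)%E.
  by apply: nneseries_ge0 => k _ _; rewrite lee_fin powR_ge0.
have inS (x : \bar R) : (0 <= x)%E -> x \in `[0%E, +oo%E].
  by move=> x0; rewrite in_itv /= x0 leey.
rewrite -poweR_EFin; split=> SB; last first.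
  by apply: gt0_ler_poweR; rewrite ?inS ?lee_fin // invr_ge0 ltW.
have := gt0_ler_poweR (ltW s0) _ _ SB.
rewrite !inS ?poweR_ge0 // -!poweRrM mulVf ?gt_eqF // !poweRe1 ?lee_fin //.
exact.
Qed.

Lemma ellA_norm_ge0 s f : (0 <= ellA_norm s f)%E.
Proof. exact: poweR_ge0. Qed.

Lemma ellA_norm_ltyP s f a : 0 < s -> has_power_series f a ->
  (ellA_norm s f < +oo)%E <-> exists B, lp_sum_le s a B.
Proof.
move=> s0 fa; split=> [flt|[B aB]].
  have ff : ellA_norm s f \is a fin_num by rewrite ge0_fin_numE ?ellA_norm_ge0.
  exists (fine (ellA_norm s f) `^ s).
  apply/(ellA_norm_leP s0 (powR_ge0 _ _) fa).
  by rewrite powRKV ?fine_ge0 ?ellA_norm_ge0 // fineK.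
apply: le_lt_trans (ltry (B `^ s^-1)).
exact/(ellA_norm_leP s0 (lp_sum_le_ge0 aB) fa).
Qed.

End CoefficientNorms.

(** * Hoelder's inequality and the duality map *)

Section Pairing.
Context {R : realType}.
Variables p q : R.
Hypotheses (p1 : 1 < p) (pq : p^-1 + q^-1 = 1).
Implicit Types (a b : nat -> R[i]) (z w : R[i]).

Let p0 : 0 < p. Proof. by rewrite (lt_trans _ p1). Qed.

Lemma conj_exponent_gt1 : 1 < q.
Proof.
have qV : q^-1 = 1 - p^-1 by rewrite -pq addrC addKr.
have : 0 < q^-1 by rewrite qV subr_gt0 invf_lt1.
move=> qV0; have q0 : 0 < q by rewrite -invr_gt0.
rewrite -invf_lt1 // qV gtrBl invr_gt0 //.
Qed.

Let q1 := conj_exponent_gt1.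
Let q0 : 0 < q. Proof. by rewrite (lt_trans _ q1). Qed.

Lemma conj_exponent_mul : p * q = p + q.
Proof.
rewrite -[LHS]mulr1 -pq; field.
by rewrite !gt_eqF.
Qed.

(** Hoelder's inequality, obtained from Young's after scaling both factors to
    norm one. *)
Lemma hoelder_sum_le a b A B : lp_sum_le p a A -> lp_sum_le q b B ->
  forall N, \sum_(0 <= k < N) modulus (a k * b k) <= A `^ p^-1 * B `^ q^-1.
Proof.
move=> aA bB N.
have A0 := lp_sum_le_ge0 aA; have B0 := lp_sum_le_ge0 bB.
have [Az|An] := eqVneq A 0.
  rewrite big1 ?mulr_ge0 ?powR_ge0 // => k _.
  have := lp_sum_le_bounded p0 aA k; rewrite Az powR0 ?invr_eq0 ?gt_eqF //.
  move=> a0; rewrite modulusM; suff -> : modulus (a k) = 0 by rewrite mul0r.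
  by apply/eqP; rewrite eq_le a0 modulus_ge0.
have [Bz|Bn] := eqVneq B 0.
  rewrite big1 ?mulr_ge0 ?powR_ge0 // => k _.
  have := lp_sum_le_bounded q0 bB k; rewrite Bz powR0 ?invr_eq0 ?gt_eqF //.
  move=> b0; rewrite modulusM; suff -> : modulus (b k) = 0 by rewrite mulr0.
  by apply/eqP; rewrite eq_le b0 modulus_ge0.
have {A0 An}A0 : 0 < A by rewrite lt_neqAle eq_sym An.
have {B0 Bn}B0 : 0 < B by rewrite lt_neqAle eq_sym Bn.
pose x := A `^ p^-1; pose y := B `^ q^-1.
have x0 : 0 < x by exact: powR_gt0.
have y0 : 0 < y by exact: powR_gt0.
rewrite -/x -/y -[leRHS]mul1r -ler_pdivrMr ?mulr_gt0 // mulr_suml.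
apply: (@le_trans _ _ (\sum_(0 <= k < N)
   (modulus (a k) `^ p / A / p + modulus (b k) `^ q / B / q))).
  apply: ler_sum => k _; rewrite modulusM invfM mulrACA.
  have := @conjugate_powR _ (modulus (a k) / x) (modulus (b k) / y) p q.
  rewrite !divr_ge0 ?modulus_ge0 ?(ltW x0) ?(ltW y0) // => /(_ isT isT p0 q0 pq).
  by rewrite !powR_div_root ?modulus_ge0 ?(ltW A0) ?(ltW B0).
rewrite big_split /= -!mulr_suml -pq lerD //.
- by rewrite ler_piMl ?invr_ge0 ?(ltW p0) // ler_pdivrMr // mul1r aA.
- by rewrite ler_piMl ?invr_ge0 ?(ltW q0) // ler_pdivrMr // mul1r bB.
Qed.

(** The duality map: [duality w] is the gradient direction of [|.|^q / q] at
    [w], and carries an l^q sequence to the l^p sequence that norms it. *)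
Definition duality w : R[i] := (modulus w `^ (q - 2))%:C * w^*%C.

Lemma modulus_duality w : modulus (duality w) = modulus w `^ (q - 1).
Proof.
rewrite /duality modulusM modulus_conj modulus_real ger0_norm ?powR_ge0 //.
have [->|w0] := eqVneq w 0.
  by rewrite modulus0 mulr0 powR0 // subr_eq0 gt_eqF.
rewrite mulrC -{1}(powRr1 (modulus_ge0 w)) -powRD.
  by congr (_ `^ _); ring.
by rewrite modulus_eq0 w0 implybT.
Qed.

Lemma duality_powR w : modulus (duality w) `^ p = modulus w `^ q.
Proof.
rewrite modulus_duality -powRrM; congr (_ `^ _).
by rewrite mulrBl mul1r mulrC conj_exponent_mul addrC addKr.
Qed.

Lemma duality_mul w : duality w * w = (modulus w `^ q)%:C.
Proof.
rewrite /duality -mulrA [_^*%C * _]mulrC -sqr_normc modulusE.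
rewrite -rmorphXn -rmorphM; congr (_%:C).
rewrite -powR_mulrn ?modulus_ge0 // -powRD ?subrK //.
by rewrite gt_eqF.
Qed.

(** Convexity of [|.|^q] in gradient form; this is Young's inequality for the
    pair [modulus (duality w)], [modulus z]. *)
Lemma duality_gradient z w :
  modulus w `^ q + q * complex.Re (duality w * (z - w)) <= modulus z `^ q.
Proof.
rewrite mulrBr duality_mul raddfB /= mulrBr.
have re : complex.Re (duality w * z) <= modulus (duality w) * modulus z.
  by rewrite -modulusM (le_trans (ler_norm _)) // Re_le_modulus.
have := @conjugate_powR _ _ _ p q (modulus_ge0 (duality w)) (modulus_ge0 z)
  p0 q0 pq.
rewrite duality_powR => /(le_trans re).
rewrite -(ler_pM2l q0) mulrDr [q * (_ / q)]mulrC divfK ?gt_eqF //.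
have -> : q * (modulus w `^ q / p) = (q - 1) * modulus w `^ q.
  rewrite mulrCA mulrC; congr (_ * _).
  by apply: (mulIf (x := p)); rewrite ?gt_eqF // divfK ?gt_eqF // mulrBl
     mulrC conj_exponent_mul mul1r addrC addKr.
set X := modulus w `^ q; set Y := complex.Re _; lra.
Qed.

Lemma duality_cvg (T : Type) (F : set_system T) {FF : Filter F}
    (u : T -> R[i]^o) (l : R[i]^o) :
  u @ F --> l -> (fun t => duality (u t) : R[i]^o) @ F --> (duality l : R[i]^o).
Proof.
move=> ul; have mu : (fun t => modulus (u t)) @ F --> modulus l by exact: cvg_modulus.
have [lz|l0] := eqVneq l 0.
  apply/cvg_modulusP.
  rewrite [X in X @ _ --> _](_ : _ = fun t => modulus (u t) `^ (q - 1)).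
    have -> : (0 : R) = modulus l `^ (q - 1).
      by rewrite lz modulus0 powR0 // subr_eq0 gt_eqF.
    apply: powR_cvg_nneg mu; rewrite ?subr_gt0 ?modulus_ge0 // => t.
    exact: modulus_ge0.
  apply/funext => t; rewrite lz /duality modulus0 rmorph0 mulr0 subr0.
  exact: modulus_duality.
have ml : 0 < modulus l by rewrite lt_neqAle modulus_ge0 eq_sym modulus_eq0 l0.
have pc : (fun t => modulus (u t) `^ (q - 2)) @ F --> modulus l `^ (q - 2).
  have /differentiable_continuous lc :
      differentiable (fun x : R => x `^ (q - 2)) (modulus l).
    by apply/derivable1_diffP; apply: derivable_powR; rewrite in_itv /= andbT.
  exact: cvg_comp mu lc.
have dE w : duality w = (modulus w `^ (q - 2) * complex.Re w)
    +i* (- (modulus w `^ (q - 2) * complex.Im w)).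
  by case: w => x y; rewrite /duality; simpc.
rewrite dE [X in X @ _ --> _](_ : _ = fun t =>
    (modulus (u t) `^ (q - 2) * complex.Re (u t))
    +i* (- (modulus (u t) `^ (q - 2) * complex.Im (u t)))); last first.
  by apply/funext => t; rewrite dE.
by apply: cvg_complex; [apply: cvgM|apply: cvgN; apply: cvgM] => //;
  [exact: cvg_Re|exact: cvg_Im].
Qed.

End Pairing.

(** * The first variation along a minimizing sequence *)

Section LimitFunctional.
Context {R : realType}.

(** The cluster point given by compactness is a limit along an ultrafilter.  One
    ultrafilter serves all sequences, hence all coordinates, at once. *)
Lemma ultra_bounded_cvg (U : set_system nat) (UU : UltraFilter U)
    (u : nat -> R) (M : R) :
  (forall n, `|u n| <= M) -> exists l : R, u @ U --> l.
Proof.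
move=> uM.
have /segment_compact [] : (u @ U) `[- M, M]%classic.
  by apply: nearW => n /=; rewrite in_itv /= -ler_norml.
move=> l [_ lU]; exists l => A Al.
have [//|UA] := in_ultra_setVsetC (u @^-1` A) UU.
by have [x []] := lU (~` A) A UA Al.
Qed.

Lemma ultra_bounded_complex_cvg (U : set_system nat) (UU : UltraFilter U)
    (u : nat -> R[i]^o) (M : R) :
  (forall n, modulus (u n) <= M) -> exists l : R[i]^o, u @ U --> l.
Proof.
move=> uM.
have [n|x ux] := @ultra_bounded_cvg U UU (fun n => complex.Re (u n)) M.
  exact: le_trans (Re_le_modulus _) (uM n).
have [n|y uy] := @ultra_bounded_cvg U UU (fun n => complex.Im (u n)) M.
  exact: le_trans (Im_le_modulus _) (uM n).
exists (x +i* y); rewrite [X in X @ _ --> _](_ : _ = fun n =>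
  complex.Re (u n) +i* complex.Im (u n)); first exact: cvg_complex.
by apply/funext => n; case: (u n).
Qed.

Lemma geometric_tail_small (r C e : R) : 0 <= r -> r < 1 -> 0 < e ->
  exists K : nat, C * (r ^+ K / (1 - r)) <= e.
Proof.
move=> r0 r1 e0.
have : (fun K => (C / (1 - r)) * r ^+ K) @ \oo --> (0 : R).
  by apply: cvg_geometric; rewrite ger0_norm.
move=> /cvgrPdist_lt /(_ _ e0) [K _ /(_ K (leqnn _))] /=.
rewrite sub0r normrN => /ltW /(le_trans (ler_norm _)) h.
by exists K; apply: le_trans h; rewrite mulrA mulrAC.
Qed.

Lemma harmonic_le1 n : harmonic n <= 1 :> R.
Proof. by rewrite /harmonic /= invf_le1 ?ler1n ?ltr0n. Qed.

Lemma cvg_sum_nat (T : Type) (F : set_system T) {FF : Filter F}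
    (K : nat) (u : nat -> T -> R) (l : nat -> R) :
  (forall k, u k @ F --> l k) ->
  (fun t => \sum_(0 <= k < K) u k t) @ F --> \sum_(0 <= k < K) l k.
Proof.
move=> ul; elim: K => [|K ih].
  rewrite big_geq // [X in X @ _ --> _](_ : _ = fun=> 0); first exact: cvg_cst.
  by apply/funext => t; rewrite big_geq.
rewrite big_nat_recr //= [X in X @ _ --> _](_ : _ = fun t =>
  (\sum_(0 <= k < K) u k t) + u K t); first exact: cvgD.
by apply/funext => t; rewrite big_nat_recr.
Qed.

Lemma cvg_ReMr (T : Type) (F : set_system T) {FF : Filter F}
    (u : T -> R[i]^o) (l : R[i]^o) (c : R[i]) :
  u @ F --> l ->
  (fun t => complex.Re ((u t : R[i]) * c)) @ F --> complex.Re ((l : R[i]) * c).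
Proof.
have ReM (x y : R[i]) : complex.Re (x * y) =
    complex.Re x * complex.Re y - complex.Im x * complex.Im y.
  by case: x; case: y.
move=> ul; rewrite ReM [X in X @ _ --> _](_ : _ = fun t =>
  complex.Re (u t) * complex.Re c - complex.Im (u t) * complex.Im c).
  apply: cvgB; apply: cvgM; try exact: cvg_cst.
  - exact: cvg_Re.
  - exact: cvg_Im.
by apply/funext => t; rewrite ReM.
Qed.

(** Fatou's lemma for coordinatewise convergence. *)
Lemma lp_sum_le_cvg (U : set_system nat) {UU : ProperFilter U} (s : R)
    (g : nat -> nat -> R[i]^o) (G : nat -> R[i]^o) (B : nat -> R) (l : R) :
  0 < s -> (forall k, g ^~ k @ U --> G k) -> B @ U --> l ->
  (forall n, lp_sum_le s (g n) (B n)) -> lp_sum_le s G l.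
Proof.
move=> s0 gG Bl gB N.
have gN : (fun n => \sum_(0 <= k < N) modulus (g n k) `^ s) @ U -->
    \sum_(0 <= k < N) modulus (G k) `^ s.
  apply: cvg_sum_nat => k; apply: powR_cvg_nneg => // [n||].
  - exact: modulus_ge0.
  - exact: modulus_ge0.
  - exact: cvg_modulus.
by apply: ler_cvg_to gN Bl _; apply: nearW => n; exact: gB.
Qed.

Variables p q : R.
Hypotheses (p1 : 1 < p) (pq : p^-1 + q^-1 = 1).

Let q1 : 1 < q. Proof. exact: conj_exponent_gt1 pq. Qed.
Let q0 : 0 < q. Proof. exact: lt_trans q1. Qed.
Let p0 : 0 < p. Proof. exact: lt_trans p1. Qed.

Lemma lp_sum_le_duality (g : nat -> R[i]) B :
  lp_sum_le q g B -> lp_sum_le p (fun k => duality q (g k)) B.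
Proof.
move=> gB N; apply: le_trans (gB N); apply: ler_sum => k _.
by rewrite (duality_powR p1).
Qed.

(** Moving [g n] by [t_n c z^k], with [t_n = harmonic n], may not lower the power
    sum below [m (1 + q t_n x)].  By the gradient inequality at the moved point
    it exceeds that of [g n] by at most [q t_n] times the pairing there; since
    the excess [t_n ^ 2] is negligible before [t_n], the limit bounds the pairing
    below.  The parameter [x] is the rate at which the direction changes the
    multiple of the target kernel: [0] for the other kernels, [1] for the target
    itself. *)
Lemma limit_first_variation (U : set_system nat) (UU : ProperFilter U)
    (g : nat -> nat -> R[i]) (G : nat -> R[i]) (m x : R) (c z : R[i]) :
  \oo `<=` U -> (forall k, (g ^~ k : nat -> R[i]^o) @ U --> (G k : R[i]^o)) ->
  (forall n, lp_sum_le q (g n) (m + harmonic n ^+ 2)) ->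
  modulus z < 1 -> modulus c <= 1 ->
  (forall n B,
    lp_sum_le q (fun k => g n k + (harmonic n)%:C * c * z ^+ k) B ->
    m * (1 + q * harmonic n * x) <= B) ->
  m * x <= complex.Re (c * evalps (fun k => duality q (G k)) z).
Proof.
move=> oU gG gm z1 c1 var.
set t : nat -> R := harmonic.
have t0 n : 0 < t n by exact: harmonic_gt0.
have t1 n : t n <= 1 by exact: harmonic_le1.
have tU : t @ U --> (0 : R) by apply: cvg_trans cvg_harmonic => A /oU.
have mU : (fun n => m + t n ^+ 2) @ U --> m.
  have : (fun n => m + t n ^+ 2) @ U --> m + 0 * 0.
    by apply: cvgD; [exact: cvg_cst|exact: cvgM].
  by rewrite mulr0 addr0.
have m0 : 0 <= m by apply: (cvgr_to_ge mU); apply: nearW => n;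
  exact: lp_sum_le_ge0 (gm n).
have Gm : lp_sum_le q G m by exact: (lp_sum_le_cvg q0 gG mU gm).
pose y n k := g n k + (t n)%:C * c * z ^+ k.
have stepE n k : modulus ((t n)%:C * c * z ^+ k) <= t n.
  rewrite !modulusM modulusX modulus_real ger0_norm ?(ltW (t0 n)) //.
  rewrite -mulrA ler_piMr ?(ltW (t0 n)) //.
  by rewrite mulr_ile1 ?exprn_ge0 ?modulus_ge0 // exprn_ile1 ?modulus_ge0 // ltW.
have yG k : (y ^~ k : nat -> R[i]^o) @ U --> (G k : R[i]^o).
  rewrite -[X in _ --> X](addr0 (G k : R[i]^o)).
  apply: (@cvgD R[i] R[i]^o _ _ _ _ _ _ _ (gG k)).
  apply/cvg_modulusP; apply: squeeze_cvgr (cvg_cst 0) tU.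
  by apply: nearW => n; rewrite subr0 modulus_ge0 stepE.
(* [C] bounds the dual sequences at the moved points, uniformly in [n]. *)
pose C := ((m + 1) `^ q^-1 + 1) `^ (q - 1).
have dC n k : modulus (duality q (y n k)) <= C.
  rewrite (modulus_duality p1 pq) ge0_ler_powR ?nnegrE ?modulus_ge0 //.
  - by rewrite subr_ge0 ltW.
  - by rewrite addr_ge0 ?powR_ge0.
  rewrite (le_trans (modulusD _ _)) // lerD ?(le_trans (stepE _ _)) //.
  apply: (lp_sum_le_bounded q0) => N; apply: le_trans (gm n N) _.
  by rewrite lerD2l expr_le1 // ltW.
pose D := m `^ p^-1.
have dD k : modulus (duality q (G k)) <= D.
  exact: (lp_sum_le_bounded p0 (lp_sum_le_duality Gm)).
apply/ler_addgt0Pl => e e0.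
have e20 : 0 < e / 2 by rewrite divr_gt0.
have [K1 K1e] := geometric_tail_small (C + D) (modulus_ge0 z) z1 e20.
have tail_ge0 : 0 <= modulus z ^+ K1 / (1 - modulus z).
  by rewrite divr_ge0 ?exprn_ge0 ?modulus_ge0 // subr_ge0 ltW.
have D0 : 0 <= D by exact: powR_ge0.
have C0 : 0 <= C by exact: powR_ge0.
pose S n := \sum_(0 <= k < K1) complex.Re (duality q (y n k) * (c * z ^+ k)).
have bound n : m * x <= t n / q + S n + e / 2.
  have tail N : (K1 <= N)%N ->
      \sum_(0 <= k < N) complex.Re (duality q (y n k) * (c * z ^+ k)) <=
      S n + e / 2.
    move=> KN; rewrite (big_cat_nat (n := K1)) //= lerD2l.
    rewrite -raddf_sum (le_trans (ler_norm _)) // (le_trans (Re_le_modulus _)) //.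
    apply: le_trans K1e.
    apply: (@le_trans _ _ (C * (modulus z ^+ K1 / (1 - modulus z)))).
      apply: modulus_series_tail => // [|k]; first exact: modulus_ge0.
      rewrite modulusM [modulus (c * _)]modulusM modulusX ler_pM ?dC ?mulr_ge0 ?exprn_ge0 ?modulus_ge0 //.
      by rewrite ler_piMl // exprn_ge0 ?modulus_ge0.
    by rewrite ler_wpM2r // lerDl.
  have yB : lp_sum_le q (y n) (m + t n ^+ 2 + q * t n * (S n + e / 2)).
    move=> N; apply: (@le_trans _ _
        (\sum_(0 <= k < maxn N K1) modulus (y n k) `^ q)).
      rewrite [leRHS](big_cat_nat (n := N)) ?leq_maxl //= lerDl.
      by rewrite sumr_ge0 // => k _; exact: powR_ge0.
    (* The gradient inequality at [y n], tested at [g n]. *)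
    rewrite -lerBlDr; apply: le_trans (gm n (maxn N K1)).
    apply: (@le_trans _ _ (\sum_(0 <= k < maxn N K1)
      (modulus (y n k) `^ q +
       q * complex.Re (duality q (y n k) * (g n k - y n k))))); last first.
      by apply: ler_sum => k _; exact: (duality_gradient p1 pq).
    rewrite big_split /= lerD2l -mulr_sumr -mulrA -mulrN ler_pM2l //.
    apply: (@le_trans _ _ (- (t n * \sum_(0 <= k < maxn N K1)
        complex.Re (duality q (y n k) * (c * z ^+ k))))).
      by rewrite lerN2 ler_pM2l // tail // leq_maxr.
    rewrite mulr_sumr -sumrN; apply: ler_sum => k _.
    have ReZ (a : R) (w : R[i]) : complex.Re (a%:C * w) = a * complex.Re w.
      by case: w => w1 w2; rewrite /= mul0r subr0.
    have -> : g n k - y n k = (- t n)%:C * (c * z ^+ k).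
      by rewrite /y rmorphN /=; ring.
    by rewrite [in leRHS]mulrCA ReZ mulNr.
  have := var n _ yB; rewrite -/t => h.
  have qt : 0 < q * t n by rewrite mulr_gt0.
  rewrite -(ler_pM2l qt) -(lerD2l m).
  have -> : m + q * t n * (m * x) = m * (1 + q * t n * x) by ring.
  suff <- : m + t n ^+ 2 + q * t n * (S n + e / 2) =
      m + q * t n * (t n / q + S n + e / 2) by [].
  by field; rewrite gt_eqF.
have SG : S @ U -->
    \sum_(0 <= k < K1) complex.Re (duality q (G k) * (c * z ^+ k)).
  apply: cvg_sum_nat => k; apply: cvg_ReMr.
  exact: (duality_cvg p1 pq).
have lim_bound : m * x <=
    0 / q + \sum_(0 <= k < K1) complex.Re (duality q (G k) * (c * z ^+ k)) + e / 2.
  have cv : (fun n => t n / q + S n + e / 2) @ U --> 0 / q +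
      \sum_(0 <= k < K1) complex.Re (duality q (G k) * (c * z ^+ k)) + e / 2.
    apply: cvgD; last exact: cvg_cst.
    by apply: cvgD => //; apply: cvgM => //; exact: cvg_cst.
  by apply: (cvgr_to_ge cv); apply: nearW.
rewrite (le_trans lim_bound) // mul0r add0r [leRHS]addrC [in leRHS](splitr e).
rewrite addrA lerD2r -lerBlDl.
have -> : \sum_(0 <= k < K1) complex.Re (duality q (G k) * (c * z ^+ k)) =
    complex.Re (c * \sum_(0 <= k < K1) duality q (G k) * z ^+ k).
  by rewrite mulr_sumr raddf_sum; apply: eq_bigr => k _; rewrite mulrCA.
rewrite -raddfB /= -mulrBr (le_trans (ler_norm _)) //.
rewrite (le_trans (Re_le_modulus _)) // modulusM modulusB.
apply: le_trans K1e; apply: le_trans (ler_piMl (modulus_ge0 _) c1) _.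
apply: (@le_trans _ _ (D * (modulus z ^+ K1 / (1 - modulus z)))).
  exact: evalps_tail.
by rewrite ler_wpM2r // lerDr.
Qed.

End LimitFunctional.

(** * Linear spans *)

Section Span.
Context {K : nzRingType} {V : lmodType K}.
Implicit Types (A : set V) (P : V -> Prop).

Lemma lspan0 A : lspan A 0.
Proof.
exists 0%N, (fun=> 0), (fun=> 0); split; first by case.
by rewrite big_ord0.
Qed.

Lemma lspanZD A (c : K) u v : A u -> lspan A v -> lspan A (c *: u + v).
Proof.
move=> Au [n [d [w [Aw ->]]]].
exists n.+1, (fun i => oapp d c (unlift ord0 i)),
  (fun i => oapp w u (unlift ord0 i)); split.
  by move=> i; case: unliftP => [j _|_] //=.
rewrite big_ord_recl unlift_none /=; congr (_ + _).
by apply: eq_bigr => i _; rewrite liftK.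
Qed.

Lemma lspan_ind A P : P 0 ->
  (forall c u v, A u -> lspan A v -> P v -> P (c *: u + v)) ->
  forall v, lspan A v -> P v.
Proof.
move=> P0 PS v [n [d [w [Aw ->]]]].
elim: n d w Aw => [|n ih] d w Aw; first by rewrite big_ord0.
rewrite big_ord_recl; apply: PS => //; last by apply: ih => i; exact: Aw.
by exists n, (fun i => d (lift ord0 i)), (fun i => w (lift ord0 i)).
Qed.

Lemma lspanZ A (c : K) v : lspan A v -> lspan A (c *: v).
Proof.
elim/lspan_ind => [|d u w Au _ ih]; first by rewrite scaler0; exact: lspan0.
by rewrite scalerDr scalerA; exact: lspanZD.
Qed.

End Span.

(** * Strict convexity of powers of the modulus *)

Section StrictConvexity.
Context {R : realType}.
Implicit Types (s t x y : R).

(** Young's inequality for [x] and [t^(s-1)], with exponents [s] and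
    [s / (s - 1)]. *)
Lemma powR_tangent s t x : 1 < s -> 0 <= t -> 0 <= x ->
  t `^ s + s * t `^ (s - 1) * (x - t) <= x `^ s.
Proof.
move=> s1 t0 x0; have s0 : 0 < s by exact: lt_trans s1.
pose r := s / (s - 1).
have s10 : 0 < s - 1 by rewrite subr_gt0.
have r0 : 0 < r by rewrite divr_gt0.
have rs : r^-1 + s^-1 = 1.
  by rewrite /r; field; rewrite !gt_eqF.
have := @conjugate_powR _ _ _ r s (powR_ge0 t (s - 1)) x0 r0 s0 rs.
have -> : (t `^ (s - 1)) `^ r = t `^ s.
  by rewrite -powRrM /r mulrC divfK ?gt_eqF.
rewrite -(ler_pM2l s0) mulrDr.
rewrite [s * (x `^ s / s)]mulrC divfK ?gt_eqF //.
have -> : s * (t `^ s / r) = s * t `^ s - t `^ s.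
  by rewrite /r; field; rewrite !gt_eqF.
have := mulr_powRB1 t0 s0.
set X := x `^ s; set T := t `^ s; set Y := t `^ (s - 1) => YT.
rewrite mulrBr -[s * Y * t]mulrA [Y * t]mulrC YT; lra.
Qed.

(** If [x < y], equality at the midpoint [t] makes the tangent at [t] meet the
    graph at [y]; the tangent at the midpoint [u] of [t] and [y] then cannot be
    steeper than the one at [t], although [t < u]. *)
Lemma powR_midpoint_eq s x y : 1 < s -> 0 <= x -> 0 <= y ->
  (x `^ s + y `^ s) / 2 <= ((x + y) / 2) `^ s -> x = y.
Proof.
move=> s1; wlog xy : x y / x <= y => [th x0 y0 h|x0 y0 h].
  have [xy|/ltW yx] := leP x y; first exact: th.
  by apply/esym/th => //; rewrite [_ `^ _ + _]addrC [y + _]addrC.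
apply/eqP; rewrite eq_le xy /= leNgt; apply/negP => {}xy.
have s0 : 0 < s by exact: lt_trans s1.
pose t := (x + y) / 2; pose u := (t + y) / 2.
have t0 : 0 <= t by rewrite divr_ge0 ?addr_ge0.
have u0 : 0 <= u by rewrite divr_ge0 ?addr_ge0.
have tu : t < u by rewrite /u /t; lra.
have := gt0_ltr_powR (_ : 0 < s - 1) t0 u0 tu.
rewrite subr_gt0 => /(_ s1).
have tx := powR_tangent s1 t0 x0.
have tu' := powR_tangent s1 t0 u0.
have uy := powR_tangent s1 u0 y0.
move: h tx tu' uy; rewrite -/t.
set X := x `^ s; set Y := y `^ s; set T := t `^ s; set W := u `^ s.
set A := t `^ _; set B := u `^ _.
have -> : x - t = - ((y - x) / 2) by rewrite /t; lra.
have -> : u - t = (y - x) / 4 by rewrite /u /t; lra.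
have -> : y - u = (y - x) / 4 by rewrite /u /t; lra.
move=> h tx tu' uy AB.
have : 0 < (B - A) * (s * (y - x)).
  by rewrite !mulr_gt0 ?subr_gt0.
nra.
Qed.

Lemma modulus_parallelogram (z w : R[i]) :
  modulus (z - w) ^+ 2 =
  2 * modulus z ^+ 2 + 2 * modulus w ^+ 2 - modulus (z + w) ^+ 2.
Proof.
case: z w => a b [c d]; rewrite /modulus /=.
by rewrite !sqr_sqrtr ?addr_ge0 ?sqr_ge0 //; ring.
Qed.

Lemma modulus_half (z w : R[i]) : modulus ((2^-1)%:C * (z + w)) = modulus (z + w) / 2.
Proof. by rewrite modulusM modulus_real ger0_norm // mulrC. Qed.

Lemma modulus_powR_midpoint s (z w : R[i]) : 1 < s ->
  modulus ((2^-1)%:C * (z + w)) `^ s <= (modulus z `^ s + modulus w `^ s) / 2.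
Proof.
move=> s1; have s0 : 0 < s by exact: lt_trans s1.
pose x := modulus z; pose y := modulus w; pose t := (x + y) / 2.
have x0 : 0 <= x by exact: modulus_ge0.
have y0 : 0 <= y by exact: modulus_ge0.
have t0 : 0 <= t by rewrite divr_ge0 ?addr_ge0.
apply: (@le_trans _ _ (t `^ s)).
  rewrite ge0_ler_powR ?nnegrE ?modulus_ge0 ?(ltW s0) // modulus_half.
  by rewrite ler_pM2r // modulusD.
have := powR_tangent s1 t0 x0; have := powR_tangent s1 t0 y0.
have -> : x - t = - ((y - x) / 2) by rewrite /t; lra.
have -> : y - t = (y - x) / 2 by rewrite /t; lra.
rewrite -/x -/y; set A := s * _; set Y := (y - x) / 2.
rewrite mulrN; set Q := A * Y; lra.
Qed.

(** Equality forces [|z| = |w| = |(z + w) / 2|], and the parallelogram law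
    concludes. *)
Lemma modulus_powR_midpoint_eq s (z w : R[i]) : 1 < s ->
  (modulus z `^ s + modulus w `^ s) / 2 <= modulus ((2^-1)%:C * (z + w)) `^ s ->
  z = w.
Proof.
move=> s1; have s0 : 0 < s by exact: lt_trans s1.
rewrite modulus_half => h.
have ms : modulus (z + w) / 2 <= (modulus z + modulus w) / 2.
  by rewrite ler_pM2r // modulusD.
have zw : modulus z = modulus w.
  apply: (powR_midpoint_eq s1); rewrite ?modulus_ge0 //.
  apply: le_trans h _; rewrite ge0_ler_powR ?nnegrE ?(ltW s0) //.
    by rewrite divr_ge0 ?modulus_ge0.
  by rewrite divr_ge0 ?addr_ge0 ?modulus_ge0.
have mz : modulus z <= modulus (z + w) / 2.
  move: h; rewrite -zw; have -> (x : R) : (x + x) / 2 = x by lra.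
  apply: contraTT; rewrite -!ltNge => h.
  by rewrite gt0_ltr_powR // nnegrE ?divr_ge0 ?modulus_ge0.
apply/eqP; rewrite -subr_eq0 -modulus_eq0 -(sqrf_eq0 (modulus _)).
rewrite eq_le sqr_ge0 andbT modulus_parallelogram -zw.
have := modulus_ge0 z; nra.
Qed.

End StrictConvexity.

(** * Interpolation and distance to the span *)

Definition kernel_span (R : realType) (Z : nat -> disk R) (j : nat) :
    set (disk R -> R[i]^o) :=
  @lspan R[i] (disk R -> R[i]^o)
    [set @Lambda R (Z k) | k in [set k | k != j]].

Lemma kernel_span0 (R : realType) (Z : nat -> disk R) j : kernel_span Z j 0.
Proof. exact: lspan0. Qed.

Lemma kernel_spanZ (R : realType) (Z : nat -> disk R) j (c : R[i]) g :
  kernel_span Z j g -> kernel_span Z j (c *: g).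
Proof. exact: lspanZ. Qed.

Lemma kernel_spanZD (R : realType) (Z : nat -> disk R) j (c : R[i]) k g :
  k != j -> kernel_span Z j g -> kernel_span Z j (c *: Lambda (Z k) + g).
Proof. by move=> kj; apply: lspanZD; exists k. Qed.

Lemma kernel_span_ind (R : realType) (Z : nat -> disk R) j
    (P : (disk R -> R[i]^o) -> Prop) : P 0 ->
  (forall (c : R[i]) k g, k != j -> P g -> P (c *: Lambda (Z k) + g)) ->
  forall g, kernel_span Z j g -> P g.
Proof.
move=> P0 PS; apply: lspan_ind => // c _ g [k kj <-] _; exact: PS.
Qed.

Section Interpolation.
Context {R : realType}.
Variables (p q : R) (Z : nat -> disk R) (j : nat).
Hypotheses (p1 : 1 < p) (pq : p^-1 + q^-1 = 1).

Let p0 : 0 < p. Proof. exact: lt_trans p1. Qed.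
Let q1 : 1 < q. Proof. exact: conj_exponent_gt1 pq. Qed.
Let q0 : 0 < q. Proof. exact: lt_trans q1. Qed.

Let V := kernel_span Z j.
Let L : disk R -> R[i]^o := Lambda (Z j).

Lemma weight_gt0 (z : disk R) : 0 < weight q z.
Proof.
rewrite powR_gt0 // subr_gt0.
have <- : 1 `^ q = 1 :> R by rewrite powR1.
by rewrite gt0_ltr_powR ?nnegrE ?modulus_ge0 // modulus_disk.
Qed.

Lemma power_series_value f a A (z : disk R) : has_power_series f a ->
  lp_sum_le p a A -> f z = evalps a (\val z).
Proof.
move=> fa aA; have ab := lp_sum_le_bounded p0 aA.
by rewrite (has_power_series_fun fa (has_power_series_evalps ab)).
Qed.

Lemma interpolantsP f : interpolants p q Z j f <->
  exists a A, [/\ has_power_series f a, lp_sum_le p a A,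
    evalps a (\val (Z j)) = ((weight q (Z j))^-1)%:C &
    forall k, k != j -> evalps a (\val (Z k)) = 0].
Proof.
have w0 z : (weight q z)%:C != 0 :> R[i].
  by rewrite -modulus_eq0 modulus_real normr_eq0 gt_eqF // weight_gt0.
split=> [[[[a fa] fn] fj fk]|[a [A [fa aA aj ak]]]].
  have [A aA] := (ellA_norm_ltyP p0 fa).1 fn.
  exists a, A; split=> // [|k kj]; rewrite -(power_series_value _ fa aA).
    by apply: (mulfI (w0 (Z j))); rewrite fj -rmorphM /= mulfV // gt_eqF // weight_gt0.
  by have /eqP := fk k kj; rewrite mulf_eq0 (negPf (w0 _)) => /eqP.
split; first by split; [exists a|apply/(ellA_norm_ltyP p0 fa); exists A].
  rewrite (power_series_value _ fa aA) aj -rmorphM /= mulfV //.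
  by rewrite gt_eqF // weight_gt0.
by move=> k kj; rewrite (power_series_value _ fa aA) ak // mulr0.
Qed.

(** Annihilating the kernels annihilates their span; the geometric decay of the
    coefficients, carried along the induction, puts the span in every l^s. *)
Lemma span_power_series g : V g -> exists b M r, [/\ 0 <= r < 1,
  has_power_series g b, (forall k, modulus (b k) <= M * r ^+ k) &
  forall a C, (forall k, modulus (a k) <= C) ->
    (forall k, k != j -> evalps a (\val (Z k)) = 0) ->
    (fun N => modulus (\sum_(0 <= k < N) a k * b k)) @ \oo --> (0 : R)].
Proof.
move: g; apply: kernel_span_ind => [|c i v ij [b [M [r [/andP[r0 r1] vb bM b0]]]]].
  exists (fun=> 0), 0, 0; split.
  - by rewrite lexx ltr01.
  - exact: has_power_series0.
  - by move=> k; rewrite modulus0 mul0r.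
  move=> a C _ _; rewrite [X in X @ _ --> _](_ : _ = fun=> 0).
    exact: cvg_cst.
  apply/funext => n; rewrite big1 ?modulus0 // => k _.
  by rewrite mulr0.
pose z := \val (Z i); have z1 : modulus z < 1 by exact: modulus_disk.
pose s := Num.max r (modulus z).
have M0 : 0 <= M.
  by have := le_trans (modulus_ge0 _) (bM 0%N); rewrite expr0 mulr1.
exists (fun k => c * z ^+ k + b k), (modulus c + M), s; split.
- by rewrite le_max r0 /= gt_max r1 z1.
- apply: has_power_seriesD vb; apply: has_power_seriesZ.
  exact: Lambda_power_series.
- move=> k; rewrite (le_trans (modulusD _ _)) // mulrDl lerD //.
    rewrite modulusM modulusX ler_wpM2l ?modulus_ge0 //.
    by rewrite lerXn2r ?nnegrE ?modulus_ge0 ?le_max ?r0 ?lexx ?orbT.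
  rewrite (le_trans (bM k)) // ler_wpM2l //.
  by rewrite lerXn2r ?nnegrE ?le_max ?r0 ?lexx.
move=> a C aC a0.
have ez : evalps a z = 0 by exact: a0.
have H1 : (fun N => modulus (\sum_(0 <= k < N) a k * z ^+ k)) @ \oo --> (0 : R).
  by have := evalps_modulus_cvg aC z1; rewrite ez modulus0.
have H2 : (fun N => modulus c * modulus (\sum_(0 <= k < N) a k * z ^+ k) +
    modulus (\sum_(0 <= k < N) a k * b k)) @ \oo --> modulus c * 0 + 0.
  by apply: cvgD; [apply: cvgM => //; exact: cvg_cst|exact: b0 aC a0].
rewrite mulr0 addr0 in H2; apply: squeeze_cvgr (cvg_cst 0) H2.
apply: nearW => N; rewrite modulus_ge0 /=.
have -> : \sum_(0 <= k < N) a k * (c * z ^+ k + b k) =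
    c * \sum_(0 <= k < N) a k * z ^+ k + \sum_(0 <= k < N) a k * b k.
  rewrite mulr_sumr -big_split /=.
  by apply: eq_bigr => k _; rewrite mulrDr [a k * (c * _)]mulrCA.
by rewrite (le_trans (modulusD _ _)) // modulusM.
Qed.

(** The duality between the two extremal problems: [a] sees [Lambda (Z j)] and
    [Lambda (Z j) - g] alike, and Hoelder's inequality applies to the latter. *)
Lemma interpolation_hoelder g : V g -> exists y,
  [/\ has_power_series (L - g) y, (exists B, lp_sum_le q y B) &
  forall a A B, lp_sum_le p a A ->
    (forall k, k != j -> evalps a (\val (Z k)) = 0) -> lp_sum_le q y B ->
    modulus (evalps a (\val (Z j))) <= A `^ p^-1 * B `^ q^-1].
Proof.
move=> /span_power_series [b [M [r [/andP[r0 r1] gb bM b0]]]].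
pose z := \val (Z j); have z1 : modulus z < 1 by exact: modulus_disk.
have M0 : 0 <= M.
  by have := le_trans (modulus_ge0 _) (bM 0%N); rewrite expr0 mulr1.
exists (fun k => z ^+ k + -1 * b k); split.
- rewrite -[- g]scaleN1r; apply: has_power_seriesD.
    exact: Lambda_power_series.
  exact: has_power_seriesZ.
- apply: (@geometric_lp_sum_le _ _ _ (1 + M) (Num.max r (modulus z))) => //.
  + by rewrite le_max r0.
  + by rewrite gt_max r1 z1.
  move=> k; rewrite (le_trans (modulusD _ _)) // mulrDl mul1r lerD //.
    rewrite modulusX lerXn2r ?nnegrE ?modulus_ge0 ?le_max ?r0 ?lexx ?orbT //.
  rewrite mulN1r modulusN (le_trans (bM k)) // ler_wpM2l //.
  by rewrite lerXn2r ?nnegrE ?le_max ?r0 ?lexx.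
move=> a A B aA a0 yB; have aC := lp_sum_le_bounded p0 aA.
have azc : (fun N => modulus (\sum_(0 <= k < N) a k * z ^+ k)) @ \oo -->
    modulus (evalps a z).
  exact: evalps_modulus_cvg aC z1.
have rhs : (fun N => A `^ p^-1 * B `^ q^-1 +
    modulus (\sum_(0 <= k < N) a k * b k)) @ \oo --> A `^ p^-1 * B `^ q^-1 + 0.
  by apply: cvgD; [exact: cvg_cst|exact: b0 aC a0].
rewrite addr0 in rhs; apply: ler_cvg_to azc rhs _; apply: nearW => N.
have -> : \sum_(0 <= k < N) a k * z ^+ k =
    \sum_(0 <= k < N) a k * (z ^+ k + -1 * b k) + \sum_(0 <= k < N) a k * b k.
  rewrite -big_split /=; apply: eq_bigr => k _.
  by rewrite -mulrDr mulN1r subrK.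
rewrite (le_trans (modulusD _ _)) // lerD2r (le_trans (modulus_sum _ _ _)) //.
exact: (hoelder_sum_le p1 pq aA yB).
Qed.

Lemma interpolant_dist_gt0 f : interpolants p q Z j f ->
  (0 < ellA_dist q L V)%E.
Proof.
move=> /interpolantsP [a [A [fa aA aj ak]]].
have w0 : 0 < (weight q (Z j))^-1 by rewrite invr_gt0 weight_gt0.
pose x := A `^ p^-1.
have lower g : V g -> ((weight q (Z j))^-1%:E <= x%:E * ellA_norm q (L - g)%R)%E.
  move=> /interpolation_hoelder [y [gy [B yB] yH]].
  have gfin : ellA_norm q (L - g)%R \is a fin_num.
    rewrite ge0_fin_numE ?ellA_norm_ge0 //.
    by apply/(ellA_norm_ltyP q0 gy); exists B.
  pose v := fine (ellA_norm q (L - g)%R).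
  have v0 : 0 <= v by rewrite fine_ge0 ?ellA_norm_ge0.
  have yv : lp_sum_le q y (v `^ q).
    apply/(ellA_norm_leP q0 (powR_ge0 _ _) gy).
    by rewrite powRKV // /v fineK.
  have := yH a A _ aA ak yv.
  rewrite aj modulus_real ger0_norm ?(ltW w0) // powRKV //.
  by rewrite -(fineK gfin) -EFinM lee_fin.
have x0 : 0 < x.
  rewrite lt_neqAle powR_ge0 andbT; apply/eqP => xz.
  have := lower 0 (kernel_span0 _ _); rewrite -xz mul0e lee_fin leNgt.
  by rewrite w0.
apply: (@lt_le_trans _ _ ((weight q (Z j))^-1 / x)%:E).
  by rewrite lte_fin divr_gt0.
apply/ereal_infP => _ [g Vg <-].
rewrite EFinM muleC.
have -> : ellA_norm q (L - g)%R = (x^-1%:E * (x%:E * ellA_norm q (L - g)%R))%E.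
  by rewrite muleA -EFinM mulVf ?gt_eqF // mul1e.
by rewrite lee_pmul2l ?lte_fin ?invr_gt0 //; exact: lower.
Qed.

(** The extremal functional: the duality map applied to the coordinatewise
    limit of a sequence minimizing the distance. *)
Lemma extremal_functional : (0 < ellA_dist q L V)%E ->
  exists (a : nat -> R[i]) (m : R), [/\ 0 < m, lp_sum_le p a m,
    (forall k, k != j -> evalps a (\val (Z k)) = 0),
    m <= complex.Re (evalps a (\val (Z j))) &
    forall e, 0 < e -> exists g y, [/\ V g, has_power_series (L - g) y &
      lp_sum_le q y (m + e)]].
Proof.
move=> dist0.
have [d d0 dist_ge] : exists2 d : R, 0 < d & (d%:E <= ellA_dist q L V)%E.
  case: (ellA_dist q L V) dist0 => [r r0|_|//]; first by exists r.
  by exists 1; rewrite ?leey.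
pose E : set R := [set B | exists g y,
  [/\ V g, has_power_series (L - g) y & lp_sum_le q y B]].
have Ed : lbound E (d `^ q).
  move=> B [g [y [Vg gy yB]]].
  have B0 := lp_sum_le_ge0 yB.
  have : (d%:E <= (B `^ q^-1)%:E)%E.
    apply: le_trans dist_ge _; apply: le_trans (_ : _ <= ellA_norm q (L - g)%R)%E _.
      by apply: ereal_inf_lbound; exists g.
    exact/(ellA_norm_leP q0 B0 gy).
  rewrite lee_fin => dB; rewrite -(powRVK q0 B0).
  by rewrite ge0_ler_powR ?nnegrE ?powR_ge0 ?(ltW q0) ?(ltW d0).
have E0 : E !=set0.
  have [y [gy [B yB] _]] := interpolation_hoelder (kernel_span0 Z j).
  by exists B, 0, y; split=> //; exact: kernel_span0.
have Einf : has_inf E by split=> //; exists (d `^ q).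
pose m := inf E.
have m_le B : E B -> m <= B by apply: ge_inf; exists (d `^ q).
have m0 : 0 < m.
  by apply: (@lt_le_trans _ _ (d `^ q)); [exact: powR_gt0|exact: lb_le_inf].
have approx e : 0 < e -> exists g y, [/\ V g, has_power_series (L - g) y &
    lp_sum_le q y (m + e)].
  move=> e0; have [B [g [y [Vg gy yB]]] Be] := inf_adherent e0 Einf.
  exists g, y; split=> // N; exact: le_trans (yB N) (ltW Be).
have /choice [gy gyP] : forall n : nat,
    exists gy : (disk R -> R[i]^o) * (nat -> R[i]),
    [/\ V gy.1, has_power_series (L - gy.1) gy.2 &
     lp_sum_le q gy.2 (m + harmonic n ^+ 2)].
  move=> n; have [|g [y gyP]] := approx (harmonic n ^+ 2).
    by rewrite exprn_gt0 // harmonic_gt0.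
  by exists (g, y).
have [U [UU oU]] := ultraFilterLemma (F := \oo) _.
have /choice [G yG] : forall k, exists l : R[i],
    ((fun n => (gy n).2 k) : nat -> R[i]^o) @ U --> (l : R[i]^o).
  move=> k; apply: (@ultra_bounded_complex_cvg _ U UU _ ((m + 1) `^ q^-1)) => n.
  have [_ _ yn] := gyP n.
  apply: (lp_sum_le_bounded q0) => N; apply: le_trans (yn N) _.
  by rewrite lerD2l expr_le1 ?harmonic_le1 // ltW // harmonic_gt0.
have ym n : lp_sum_le q (gy n).2 (m + harmonic n ^+ 2) by case: (gyP n).
have UP : ProperFilter U by exact: ultra_proper.
have mU : (fun n => m + harmonic n ^+ 2 : R) @ U --> m.
  have hU : (harmonic : nat -> R) @ U --> (0 : R).
    by apply: cvg_trans cvg_harmonic => A /oU.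
  have : (fun n => m + harmonic n ^+ 2 : R) @ U --> m + 0 * 0.
    by apply: cvgD; [exact: cvg_cst|exact: cvgM].
  by rewrite mulr0 addr0.
have Gm : lp_sum_le q G m by exact: (lp_sum_le_cvg q0 yG mU ym).
exists (fun k => duality q (G k)), m; split=> //.
- exact: (lp_sum_le_duality p1).
(* Varying along another kernel stays inside the class of competitors. *)
- move=> k kj; set P := evalps _ _.
  have ReP (c : R[i]) : modulus c <= 1 -> 0 <= complex.Re (c * P).
    move=> c1; rewrite -(mulr0 m).
    apply: (limit_first_variation p1 pq UP oU yG ym (modulus_disk (Z k)) c1).
    move=> n B yB; rewrite mulr0 addr0 mulr1; apply: m_le.
    have [Vg gyn _] := gyP n.
    pose t : R[i] := (harmonic n)%:C * c.
    exists ((- t) *: Lambda (Z k) + (gy n).1).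
    exists (fun i => (gy n).2 i + t * \val (Z k) ^+ i); split.
    - exact: kernel_spanZD.
    - rewrite scaleNr opprD opprK addrCA [X in has_power_series X]addrC.
      apply: has_power_seriesD gyn _; apply: has_power_seriesZ.
      exact: Lambda_power_series.
    - exact: yB.
  have m1 : modulus (1 : R[i]) <= 1 by rewrite modulus1.
  have mi : modulus ('i%C : R[i]) <= 1.
    by rewrite /modulus /= expr0n expr1n add0r sqrtr1.
  have h1 := ReP 1 m1; have h2 := ReP 'i%C mi.
  have h3 : 0 <= complex.Re (- 1 * P) by apply: ReP; rewrite modulusN.
  have h4 : 0 <= complex.Re (- 'i%C * P) by apply: ReP; rewrite modulusN.
  clearbody P; case: P h1 h2 h3 h4 {ReP} => x y /= h1 h2 h3 h4.
  by apply/eqP; rewrite eq_complex /=; apply/andP; split; apply/eqP; lra.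
(* Varying along the target multiplies it by [1 + t]; dividing by this factor
   gives a competitor, and Bernoulli's inequality [1 + q t <= (1 + t)^q] gives
   the rate [1]. *)
- rewrite -[leLHS]mulr1 -[X in complex.Re X]mul1r.
  apply: (limit_first_variation p1 pq UP oU yG ym (modulus_disk (Z j))).
    by rewrite modulus1.
  move=> n B yB; rewrite !mulr1 in yB *.
  set t : R := harmonic n in yB *.
  have t0 : 0 < t by exact: harmonic_gt0.
  have t10 : 0 < 1 + t by rewrite addr_gt0.
  have [Vg gyn _] := gyP n.
  have tp : 0 < (1 + t) `^ q by exact: powR_gt0.
  have bern : 1 + q * t <= (1 + t) `^ q.
    have := powR_tangent q1 ler01 (ltW t10).
    by rewrite !powR1 mulr1 addrAC subrr add0r.
  have : m <= ((1 + t) `^ q)^-1 * B.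
    apply: m_le; pose s : R[i] := ((1 + t)^-1)%:C.
    exists (s *: (gy n).1), (fun i => s * ((gy n).2 i + t%:C * \val (Z j) ^+ i)).
    split; first exact: kernel_spanZ.
      have -> : L - s *: (gy n).1 = s *: ((L - (gy n).1) + t%:C *: L).
        have st : s * (1 + t%:C) = 1.
          have -> : 1 + t%:C = (1 + t)%:C :> R[i] by rewrite rmorphD rmorph1.
          by rewrite -rmorphM mulVf ?gt_eqF // rmorph1.
        rewrite addrAC scalerBr -[X in s *: (X + _)]scale1r -scalerDl scalerA.
        by rewrite st scale1r.
      apply: has_power_seriesZ; apply: has_power_seriesD gyn _.
      by apply: has_power_seriesZ; exact: Lambda_power_series.
    have := lp_sum_leZ s yB; rewrite /s modulus_real ger0_norm ?invr_ge0 ?ltW //.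
    have -> // : ((1 + t)^-1) `^ q = ((1 + t) `^ q)^-1.
    by rewrite -powR_inv1 ?ltW // powRAC powR_inv1 ?powR_ge0.
  rewrite mulrC ler_pdivlMr // => mB; apply: le_trans mB.
  by rewrite ler_pM2l.
Qed.

End Interpolation.

(** * Existence and uniqueness of minimal interpolants *)

Section MinimalInterpolants.
Context {R : realType}.
Variables (p q : R) (Z : nat -> disk R) (j : nat).
Hypotheses (p1 : 1 < p) (pq : p^-1 + q^-1 = 1).

Let p0 : 0 < p. Proof. exact: lt_trans p1. Qed.
Let q1 : 1 < q. Proof. exact: conj_exponent_gt1 pq. Qed.
Let q0 : 0 < q. Proof. exact: lt_trans q1. Qed.

Lemma interpolant_norm f : interpolants p q Z j f -> exists2 v : R,
  0 <= v & ellA_norm p f = v%:E.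
Proof.
move=> [[_ fn] _ _]; exists (fine (ellA_norm p f)).
  by rewrite fine_ge0 ?ellA_norm_ge0.
by rewrite fineK // ge0_fin_numE ?ellA_norm_ge0.
Qed.

(** Hoelder's inequality between an interpolant and the near-minimizers of the
    distance bounds its norm below by [W^-1 / m^(1/q)], where [W] is the weight
    at [Z j]; the rescaled extremal functional reaches this bound. *)
Lemma min_interpolant_exists : (0 < ellA_dist q (Lambda (Z j)) (kernel_span Z j))%E ->
  exists f, is_min_interpolant p q Z j f.
Proof.
move=> /(extremal_functional p1 pq) [a [m [m0 am ak mP approx]]].
set P := evalps a _ in mP.
pose W := weight q (Z j); have W0 : 0 < W by exact: weight_gt0 p1 pq (Z j).
have modP : m <= modulus P.
  by rewrite (le_trans mP) // (le_trans (ler_norm _)) // Re_le_modulus.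
have P0 : 0 < modulus P by exact: lt_le_trans modP.
have Pn0 : P != 0 by rewrite -modulus_eq0 gt_eqF.
pose c : R[i] := (W^-1)%:C / P.
have cM : modulus c = W^-1 / modulus P.
  by rewrite modulusM modulusV modulus_real ger0_norm // invr_ge0 ltW.
pose b k := c * a k.
have bB : lp_sum_le p b (modulus c `^ p * m) by exact: lp_sum_leZ.
have bb := lp_sum_le_bounded p0 bB.
pose f (z : disk R) : R[i]^o := evalps b (\val z).
have fb : has_power_series f b by exact: has_power_series_evalps bb.
have evalb (z : disk R) : evalps b (\val z) = c * evalps a (\val z).
  have h := has_power_series_evalps (lp_sum_le_bounded p0 am).
  by rewrite -/(f z) (has_power_series_fun fb (has_power_seriesZ (c := c) h)).
have fI : interpolants p q Z j f.
  apply/(interpolantsP Z j p1 pq); exists b, (modulus c `^ p * m); split=> //.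
    by rewrite evalb -/P /c divfK.
  by move=> k kj; rewrite evalb ak // mulr0.
exists f; split; first exact: fI.
move=> h hI.
have [v v0 hv] := interpolant_norm hI.
have [d [D [hd dD dj dk]]] := (interpolantsP Z j p1 pq h).1 hI.
have dv : lp_sum_le p d (v `^ p).
  by apply/(ellA_norm_leP p0 (powR_ge0 _ _) hd); rewrite powRKV // hv.
have lower e : 0 < e -> W^-1 <= v * (m + e) `^ q^-1.
  move=> /approx [g [y [Vg gy yB]]].
  have [y' [gy' _ yH]] := interpolation_hoelder p1 pq Vg.
  have yE : y' = y by rewrite -(taylor_coefE gy') (taylor_coefE gy).
  have := yH d _ (m + e) dv dk; rewrite yE => /(_ yB).
  by rewrite dj modulus_real powRKV // ger0_norm // invr_ge0 ltW.
have vm : W^-1 <= v * m `^ q^-1.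
  have hm : (fun n => m + harmonic n : R) @ \oo --> m.
    have : (fun n => m + harmonic n : R) @ \oo --> m + 0.
      by apply: cvgD; [exact: cvg_cst|exact: cvg_harmonic].
    by rewrite addr0.
  have hv' : (fun n => v * (m + harmonic n) `^ q^-1) @ \oo --> v * m `^ q^-1.
    apply: cvgM; first exact: cvg_cst.
    apply: powR_cvg_nneg hm => [|n|]; rewrite ?invr_gt0 ?ltW //.
    by rewrite addr_gt0 // harmonic_gt0.
  apply: (cvgr_to_ge hv'); apply: nearW => n.
  by apply: lower; exact: harmonic_gt0.
apply: (@le_trans _ _ ((modulus c `^ p * m) `^ p^-1)%:E).
  exact/(ellA_norm_leP p0 (lp_sum_le_ge0 bB) fb).
rewrite hv lee_fin powRM ?powR_ge0 ?(ltW m0) // powRKV ?modulus_ge0 // cM.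
apply: (@le_trans _ _ (W^-1 / m * m `^ p^-1)).
  rewrite ler_wpM2r ?powR_ge0 // ler_wpM2l ?invr_ge0 ?(ltW W0) //.
  by rewrite lef_pV2.
have mE : m = m `^ p^-1 * m `^ q^-1.
  rewrite -powRD; first by rewrite pq powRr1 // ltW.
  by rewrite pq oner_eq0.
have mp0 : 0 < m `^ p^-1 by exact: powR_gt0.
have mq0 : 0 < m `^ q^-1 by exact: powR_gt0.
have -> : W^-1 / m * m `^ p^-1 = W^-1 / m `^ q^-1.
  by rewrite [in X in W^-1 / X * _]mE; field; rewrite !gt_eqF.
by rewrite ler_pdivrMr.
Qed.

(** Two minimal interpolants differing in one coefficient would have a midpoint
    whose [p]-th power sum is smaller by a fixed positive amount. *)
Lemma min_interpolant_unique f g : is_min_interpolant p q Z j f ->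
  is_min_interpolant p q Z j g -> f = g.
Proof.
move=> [fI fmin] [gI gmin].
have [v v0 fv] := interpolant_norm fI.
have gv : ellA_norm p g = v%:E.
  apply/eqP; rewrite -fv eq_le; apply/andP; split.
    exact: gmin fI.
  exact: fmin gI.
have [a [A [fa aA aj ak]]] := (interpolantsP Z j p1 pq f).1 fI.
have [b [B [gb bB bj bk]]] := (interpolantsP Z j p1 pq g).1 gI.
have av : lp_sum_le p a (v `^ p).
  by apply/(ellA_norm_leP p0 (powR_ge0 _ _) fa); rewrite powRKV // fv.
have bv : lp_sum_le p b (v `^ p).
  by apply/(ellA_norm_leP p0 (powR_ge0 _ _) gb); rewrite powRKV // gv.
suff ab : a = b by rewrite ab in fa; exact: has_power_series_fun fa gb.
pose half : R[i] := (2^-1)%:C.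
pose c k := half * (a k + b k).
pose defect k := (modulus (a k) `^ p + modulus (b k) `^ p) / 2 - modulus (c k) `^ p.
have defect_ge0 k : 0 <= defect k.
  by rewrite subr_ge0 modulus_powR_midpoint.
have sumE N : \sum_(0 <= k < N) modulus (c k) `^ p + \sum_(0 <= k < N) defect k <=
    v `^ p.
  rewrite -big_split /=.
  under eq_bigr do rewrite /defect addrC subrK.
  rewrite -mulr_suml big_split /= ler_pdivrMr //.
  by have := av N; have := bv N; lra.
have cv : lp_sum_le p c (v `^ p).
  move=> N; apply: le_trans (sumE N); rewrite lerDl.
  by apply: sumr_ge0 => k _.
have hc : has_power_series (half *: (f + g)) c.
  by apply: has_power_seriesZ; exact: has_power_seriesD.
have evalc (z : disk R) : evalps c (\val z) =
    half * (evalps a (\val z) + evalps b (\val z)).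
  rewrite -(power_series_value p1 z hc cv) -(power_series_value p1 z fa aA).
  by rewrite -(power_series_value p1 z gb bB).
have hI : interpolants p q Z j (half *: (f + g)).
  apply/(interpolantsP Z j p1 pq); exists c, (v `^ p); split=> //.
    rewrite evalc aj bj -rmorphD -rmorphM /=; congr (_%:C).
    by set w := (weight q (Z j))^-1; lra.
  by move=> k kj; rewrite evalc ak // bk // addr0 mulr0.
apply/funext => i; apply/eqP; apply/negPn/negP => abi.
have di : 0 < defect i.
  rewrite lt_neqAle defect_ge0 andbT eq_sym subr_eq0; apply/eqP => h.
  move/eqP : abi; apply; apply: (modulus_powR_midpoint_eq p1).
  by rewrite h.
have cd : lp_sum_le p c (v `^ p - defect i).
  move=> N; apply: (@le_trans _ _ (\sum_(0 <= k < maxn N i.+1) modulus (c k) `^ p)).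
    rewrite [leRHS](big_cat_nat (n := N)) ?leq_maxl //= lerDl.
    by rewrite sumr_ge0 // => k _; exact: powR_ge0.
  rewrite lerBrDr; apply: le_trans (sumE (maxn N i.+1)); rewrite lerD2l.
  rewrite [leRHS](big_cat_nat (n := i.+1)) ?leq_maxr //= big_nat_recr //=.
  rewrite addrAC lerDr addr_ge0 //; by apply: sumr_ge0.
have := fmin _ hI; rewrite fv => vh.
have hle := (ellA_norm_leP p0 (lp_sum_le_ge0 cd) hc).2 cd.
have := le_trans vh hle; rewrite lee_fin => vle.
have : v `^ p <= v `^ p - defect i.
  rewrite -[leRHS](powRVK p0) ?(lp_sum_le_ge0 cd) //.
  by rewrite ge0_ler_powR ?nnegrE ?powR_ge0 ?(ltW p0).
by rewrite lerBrDr gerDl leNgt di.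
Qed.

End MinimalInterpolants.

Theorem corollary4p9 (R : realType) (p q : R) (Z : nat -> disk R)
    (hp : 1 < p) (hpq : p^-1 + q^-1 = 1)
    (hZinj : injective Z) (hZ0 : forall k, \val (Z k) != 0) :
  (forall j, exists! f, is_min_interpolant p q Z j f) <->
  (forall j, (0 < ellA_dist q (@Lambda R (Z j))
                    (@lspan R[i] (disk R -> R[i]^o)
                       [set @Lambda R (Z k) | k in [set k | k != j]]))%E).
Proof.
split=> [ex j|dist j].
  have [f [[fI _] _]] := ex j.
  have dist0 := interpolant_dist_gt0 hp hpq fI; exact: dist0.
have [f fmin] := min_interpolant_exists hp hpq (dist j).
exists f; split; first exact: fmin.
move=> g gmin; exact: (min_interpolant_unique hp hpq fmin gmin).
Qed.
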